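(* Let $S$ be a solution concept (for games with a fixed player set $\{1,\dots,n\}$, $n\ge 2$) that permits bracketing and satisfies expectation-monotonicity and anonymity. Then $S$ is a refinement of $\mathrm{Nash}$, or there exists $\lambda\ge 0$ such that $S$ is a refinement of $\mathrm{LQRE}_\lambda$.
   Context: Games. Fix an integer $n\ge 2$ and the player set $\{1,\dots,n\}$. All actions belong to a fixed nonempty universal set $\mathcal{A}$ that is closed under pairing, $\mathcal{A}\times\mathcal{A}\subseteq\mathcal{A}$ (hence infinite). A game $G=(A,u)$ consists of $A=\prod_i A_i$ with each $A_i\subset\mathcal{A}$ finite and nonempty, and $u\colon A\to\mathbb{R}^n$. A mixed strategy profile is $p=(p_1,\dots,p_n)\in\prod_i\Delta A_i$; it is identified with the product distribution on $A$, and $p_{-i}$ is its marginal on $A_{-i}=\prod_{j\ne i}A_j$. For $a_i\in A_i$, $u_i(a_i,p_{-i})$ denotes the lottery (distribution of payoffs) of player $i$ when playing $a_i$ while the others play $p_{-i}$, and $\mathbb{E}[u_i(a_i,p_{-i})]$ its expectation. Solution concepts. A solution concept $S$ assigns to each game $G=(A,u)$ a nonempty set $S(G)\subseteq\prod_i\Delta A_i$. $S$ is a refinement of $S'$ if $S(G)\subseteq S'(G)$ for all games $G$. $\mathrm{Nash}(G)$ is the set of all (mixed, including pure) Nash equilibria of $G$. For $\lambda\ge0$, $\mathrm{LQRE}_\lambda(G)$ is the set of $p\in\prod_i\Delta A_i$ such that for every $i$, $p_i(a_i)\propto\exp(\lambda\,\mathbb{E}[u_i(a_i,p_{-i})])$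 over $a_i\in A_i$ (equality up to normalization). Bracketing. For $G=(A,u)$, $H=(B,v)$ the composite game $G\otimes H=(C,w)$ has $C_i=A_i\times B_i$ and $w_i((a_1,b_1),\dots,(a_n,b_n))=u_i(a)+v_i(b)$. For profiles $p,q$ of $G,H$, $[p\times q]_i(a_i,b_i)=p_i(a_i)q_i(b_i)$. $S$ permits bracketing if for all games $G,H$: $p\in S(G)$ and $q\in S(H)$ imply $p\times q\in S(G\otimes H)$. Expectation-monotonicity. For every game $G=(A,u)$, $p\in S(G)$, player $i$, $a_i,b_i\in A_i$: $\mathbb{E}[u_i(a_i,p_{-i})]>\mathbb{E}[u_i(b_i,p_{-i})]$ implies $p_i(a_i)\ge p_i(b_i)$. Anonymity. For a permutation $\pi$ of $\{1,\dots,n\}$ and $G=(A,u)$, the permuted game $G_\pi=(B,v)$ has $B_i=A_{\pi(i)}$ and $v_i(a_{\pi(1)},\dots,a_{\pi(n)})=u_{\pi(i)}(a_1,\dots,a_n)$; the permuted profile is $(p_\pi)_i=p_{\pi(i)}$. $S$ satisfies anonymity if $p\in S(G)$ implies $p_\pi\in S(G_\pi)$ for all $G$, $\pi$. *)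

(* Defs.v *)
From HB Require Import structures.
From mathcomp Require Import all_boot all_order all_algebra all_fingroup finmap.
From mathcomp Require Import boolp classical_sets cardinality reals sequences exp.

Set Implicit Arguments.
Unset Strict Implicit.
Unset Printing Implicit Defensive.

Import Order.TTheory GRing.Theory Num.Theory.
Local Open Scope fset_scope.
Local Open Scope ring_scope.

(* The set of all actions, closed under pairing.  The inclusion of act * act
   in act is rendered as an injection [pairing].  Infiniteness, which in set
   theory follows from well-foundedness, has to be stated here: a one-point
   type also has an injective pairing. *)
Record action_universe := ActionUniverse {
  act :> choiceType;
  universe_nonempty : inhabited act;
  pairing : act * act -> act;
  pairing_inj : injective pairing;
  universe_infinite : infinite_set [set: act]
}.

Section ProductOfActionSets.
Variable U : action_universe.
Implicit Types A B : {fset U}.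

Definition pair_fset A B : {fset U} := [fset pairing (a, b) | a in A, b in B].

Lemma pair_fset_mem A B (a : A) (b : B) :
  pairing (val a, val b) \in pair_fset A B.
Proof. by apply: in_imfset2; apply: valP. Qed.

Definition join_act A B (a : A) (b : B) : pair_fset A B := [` pair_fset_mem a b].

Lemma split_exists A B (c : pair_fset A B) :
  exists ab : A * B, val c == pairing (val ab.1, val ab.2).
Proof.
have /imfset2P[a aA [b bB ->]] := valP c.
by exists ([` aA], [` bB]).
Qed.

(* The two components of an element of A x B; unique since [pairing] is
   injective. *)
Definition split_act A B (c : pair_fset A B) : A * B := xchoose (split_exists c).

Definition fst_act A B (c : pair_fset A B) : A := (split_act c).1.

Definition snd_act A B (c : pair_fset A B) : B := (split_act c).2.

Lemma join_split A B (c : pair_fset A B) : join_act (fst_act c) (snd_act c) = c.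
Proof. by apply: val_inj; rewrite /= -(eqP (xchooseP (split_exists c))). Qed.

Lemma split_join A B (a : A) (b : B) : split_act (join_act a b) = (a, b).
Proof.
have /eqP/(@pairing_inj U) := xchooseP (split_exists (join_act a b)).
rewrite -/(split_act (join_act a b)); case: (split_act _) => a' b' /= [eqa eqb].
by congr (_, _); apply: val_inj.
Qed.

Lemma fst_join A B (a : A) (b : B) : fst_act (join_act a b) = a.
Proof. by rewrite /fst_act split_join. Qed.

Lemma snd_join A B (a : A) (b : B) : snd_act (join_act a b) = b.
Proof. by rewrite /snd_act split_join. Qed.

Lemma pair_fset_neq0 A B : A != fset0 -> B != fset0 -> pair_fset A B != fset0.
Proof.
move=> /fset0Pn[a aA] /fset0Pn[b bB]; apply/fset0Pn.
by exists (pairing (a, b)); apply: (pair_fset_mem [` aA] [` bB]).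
Qed.

End ProductOfActionSets.

Section Mixed.
Variables (R : realType) (U : action_universe).
Implicit Types A B : {fset U}.

Record mixed A := Mixed {
  prob :> A -> R;
  mixed_ge0 : forall a, 0 <= prob a;
  mixed_sum1 : \sum_(a : A) prob a = 1
}.

Lemma mixed_prod_ge0 A B (p : mixed A) (q : mixed B) (c : pair_fset A B) :
  0 <= p (fst_act c) * q (snd_act c).
Proof. by rewrite mulr_ge0 ?mixed_ge0. Qed.

Lemma mixed_prod_sum1 A B (p : mixed A) (q : mixed B) :
  \sum_(c : pair_fset A B) p (fst_act c) * q (snd_act c) = 1.
Proof.
rewrite (reindex (fun ab : A * B => join_act ab.1 ab.2)) /=; last first.
  exists (@split_act U A B) => [[a b] _|c _] /=; first exact: split_join.
  exact: join_split.
under eq_bigr do rewrite fst_join snd_join.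
rewrite -(pair_bigA _ (fun a b => p a * q b)) /=.
under eq_bigr do rewrite -mulr_sumr mixed_sum1 mulr1.
exact: mixed_sum1.
Qed.

Definition mixed_prod A B (p : mixed A) (q : mixed B) :
    mixed (pair_fset A B) :=
  Mixed (mixed_prod_ge0 p q) (mixed_prod_sum1 p q).

End Mixed.

Section Games.
Variables (R : realType) (n : nat) (U : action_universe).

Record game := Game {
  acts : 'I_n -> {fset U};
  acts_neq0 : forall i, acts i != fset0;
  util : (forall i, acts i) -> 'I_n -> R
}.

Definition profile (G : game) := forall i, mixed R (acts G i).

Definition expected_payoff (G : game) (p : profile G) (i : 'I_n) : R :=
  \sum_(a : {dffun forall j, acts G j}) (\prod_j p j (a j)) * util a i.

(* Expectation of u_i(x, p_{-i}); the profiles a with a_i = x enumerate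
   A_{-i}. *)
Definition expected_payoff_at (G : game) (p : profile G) (i : 'I_n)
    (x : acts G i) : R :=
  \sum_(a : {dffun forall j, acts G j} | a i == x)
    (\prod_(j | j != i) p j (a j)) * util a i.

Definition correspondence := forall G : game, set (profile G).

Record solution_concept := SolutionConcept {
  solutions :> forall G : game, set (profile G);
  solutions_nonempty : forall G, (@solutions G !=set0)%classic
}.

Definition refinement (S S' : correspondence) : Prop :=
  forall G, (S G `<=` S' G)%classic.

Definition Nash : correspondence := fun G p =>
  forall (i : 'I_n) (q : mixed R (acts G i)),
    expected_payoff (dfwith p q) i <= expected_payoff p i.

Definition LQRE (lambda : R) : correspondence := fun G p =>
  forall (i : 'I_n) (x : acts G i),
    p i x = expR (lambda * expected_payoff_at p x)
            / \sum_(y : acts G i) expR (lambda * expected_payoff_at p y).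

Definition composite (G H : game) : game := {|
  acts := fun i => pair_fset (acts G i) (acts H i);
  acts_neq0 := fun i => pair_fset_neq0 (acts_neq0 G i) (acts_neq0 H i);
  util := fun c i => util (fun j => fst_act (c j)) i
                     + util (fun j => snd_act (c j)) i
|}.

Definition profile_prod (G H : game) (p : profile G) (q : profile H) :
    profile (composite G H) :=
  fun i => mixed_prod (p i) (q i).

Definition permits_bracketing (S : solution_concept) : Prop :=
  forall (G H : game) (p : profile G) (q : profile H),
    S G p -> S H q -> S (composite G H) (profile_prod p q).

Definition expectation_monotone (S : solution_concept) : Prop :=
  forall (G : game) (p : profile G), S G p ->
  forall (i : 'I_n) (x y : acts G i),
    expected_payoff_at p y < expected_payoff_at p x -> p i y <= p i x.

(* The profile a of G such that a_{s(i)} = b_i for all i. *)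
Definition unpermute (G : game) (s : 'S_n) (b : forall i, acts G (s i)) :
    forall j, acts G j :=
  fun j => ecast k (acts G k) (permKV s j) (b ((s^-1)%g j)).

Lemma unpermuteE (G : game) (s : 'S_n) (a : forall j, acts G j) :
  unpermute (fun i => a (s i)) = a.
Proof.
apply: functional_extensionality_dep => j; rewrite /unpermute.
by move: (permKV s j) => /=; set k := s _ => e; case: _ / e.
Qed.

Definition permuted (G : game) (s : 'S_n) : game := {|
  acts := fun i => acts G (s i);
  acts_neq0 := fun i => acts_neq0 G (s i);
  util := fun b i => util (unpermute b) (s i)
|}.

Lemma util_permuted (G : game) (s : 'S_n) (a : forall j, acts G j) i :
  @util (permuted G s) (fun k => a (s k)) i = util a (s i).
Proof. by rewrite /= unpermuteE. Qed.

Definition profile_perm (G : game) (p : profile G) (s : 'S_n) :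
    profile (permuted G s) :=
  fun i => p (s i).

Definition anonymous (S : solution_concept) : Prop :=
  forall (G : game) (s : 'S_n) (p : profile G),
    S G p -> S (permuted G s) (profile_perm p s).

End Games.

(* Main.v *)
(* For a solution p, a player and two actions x, y, consider the triple
   (d, p x, p y), where d is the gain in expected payoff of x over y.
   Bracketing makes the set of these triples closed under
   (d + d', a a', b b'), anonymity makes it the same for every player, and
   monotonicity says that d > 0 implies a >= b.  If some triple has d > 0 and
   a > b = 0, comparing it with a large power of any other triple (d', a', b')
   with d' > 0 forces b' = 0, so only best responses are played.  Otherwise all
   probabilities are positive, and the pairs (d, ln (a / b)) form a subgroup of
   R^2 whose second component is nonnegative when the first is positive; such a
   subgroup lies on a line. *)
Require Import Defs.
From mathcomp Require Import all_boot all_order all_algebra reals.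
From mathcomp Require Import all_fingroup finmap boolp classical_sets cardinality sequences exp.
From mathcomp Require Import ring lra.

Set Implicit Arguments.
Unset Strict Implicit.
Unset Printing Implicit Defensive.

Import Order.TTheory GRing.Theory Num.Theory.
Local Open Scope ring_scope.

(** * Algebraic preliminaries: distributivity over dependent functions, additive relations *)

Lemma sum_dffun_prod (R : comPzSemiRingType) (I : finType) (T : I -> finType)
    (F : forall i, T i -> R) :
  \sum_(a : {dffun forall i, T i}) \prod_i F i (a i) = \prod_i \sum_x F i x.
Proof.
rewrite (reindex (@dffun_of_fprod I T)) /=; last first.
  exact/onW_bij/dffun_of_fprod_bij.
under eq_bigr => t _ do under eq_bigr => i _ do
  rewrite ffunE -[F i (t i)](ffunE (F i)).
(* Over families of tagged values ordinary distributivity applies; [untag] sends a value with the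
   wrong tag to 0. *)
rewrite (big_fprod _ _ (fun i => finfun (F i))).
rewrite -(bigA_distr_big_dep _ (fun i => untag 0 (finfun (F i)))); apply: eq_bigr => i _.
rewrite (big_tag F); apply: eq_big => // u _.
by congr (untag _ _ _); apply: functional_extensionality_dep => x; rewrite ffunE.
Qed.

(** The constraint [a i == x] becomes an indicator factor at [i], which reduces the claim to
    [sum_dffun_prod]. *)
Lemma sum_dffun_prod_at (R : comPzSemiRingType) (I : finType) (T : I -> finType)
    (F : forall i, T i -> R) (i : I) (x : T i) :
  \sum_(a : {dffun forall j, T j} | a i == x) \prod_(j | j != i) F j (a j)
  = \prod_(j | j != i) \sum_y F j y.
Proof.
pose D := dfwith F (fun y => (y == x)%:R : R).
have -> : \prod_(j | j != i) \sum_y F j y = \prod_j \sum_y D j y.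
  rewrite [RHS](bigD1 i) //= /D dfwith_in (bigD1 x) //= eqxx.
  rewrite [X in (1 + X) * _]big1 => [|y /negPf -> //]; rewrite addr0 mul1r.
  by apply: eq_bigr => j ji; rewrite dfwith_out // eq_sym.
rewrite -sum_dffun_prod big_mkcond; apply: eq_bigr => a _.
rewrite [RHS](bigD1 i) //= /D dfwith_in.
case: eqP => _; last by rewrite mul0r.
by rewrite mul1r; apply: eq_bigr => j ji; rewrite dfwith_out // eq_sym.
Qed.

(* If [L d l] with [l < lambda d], adding [k] copies of [(d, l)] to
   [1 - floor (k d)] copies of [(1, lambda)] gives, for large [k], a pair with
   positive first and negative second component. *)
Lemma additive_monotone_relation_linear (R : realType) (L : R -> R -> Prop) (lambda : R) :
  (forall d l d' l', L d l -> L d' l' -> L (d + d') (l + l')) ->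
  (forall d l, L d l -> L (- d) (- l)) ->
  (forall d l, L d l -> 0 < d -> 0 <= l) ->
  L 1 lambda -> forall d l, L d l -> l = lambda * d.
Proof.
move=> LD LN Lpos L1.
have L0 : L 0 0 by move: (LD _ _ _ _ L1 (LN _ _ L1)); rewrite !subrr.
have Ln d l k : L d l -> L (d *+ k) (l *+ k).
  by move=> Ldl; elim: k => [|k IH]; rewrite ?mulr0n // !mulrS; apply: LD.
have Lz d l m : L d l -> L (d *~ m) (l *~ m).
  by case: m => k Ldl; [|apply: LN]; apply: Ln.
have le d l : L d l -> lambda * d <= l.
  move=> Ldl; rewrite leNgt; apply/negP => lt_l.
  have lambda_ge0 : 0 <= lambda by apply: Lpos L1 ltr01.
  pose e := lambda * d - l.
  have e_gt0 : 0 < e by rewrite subr_gt0.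
  (* With [m = floor (k d)] the combined pair has first component in [1, 2), hence second component
     at most [2 lambda - k e]; this [k] makes that negative. *)
  pose k := Num.bound (2 * lambda / e).
  have ke : 2 * lambda < k%:R * e.
    rewrite -ltr_pdivrMr //; apply: archi_boundP.
    by rewrite divr_ge0 ?mulr_ge0 // ltW.
  pose m := Num.floor (d *+ k).
  have m_le : m%:~R <= d *+ k by apply: ge_floor.
  have m_gt : d *+ k < (m + 1)%:~R by apply: lt_succ_floor.
  have := LD _ _ _ _ (Ln _ _ k Ldl) (Lz _ _ (1 - m) L1).
  rewrite -[l *+ k]mulr_natl -[lambda *~ _]mulrzl -[1 *~ _]/(_%:~R).
  have -> : (1 - m)%:~R = 1 - m%:~R :> R by rewrite intrD intrN.
  rewrite intrD in m_gt; rewrite -[d *+ k]mulr_natl in m_gt m_le *.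
  move=> /Lpos pos.
  have {pos} : 0 <= k%:R * l + (1 - m%:~R) * lambda by apply: pos; lra.
  have : 0 <= lambda * (m%:~R + 1 - k%:R * d).
    by rewrite mulr_ge0 // subr_ge0 ltW.
  move=> h1 h2; have := addr_ge0 h1 h2.
  have -> : lambda * (m%:~R + 1 - k%:R * d) + (k%:R * l + (1 - m%:~R) * lambda)
    = 2 * lambda - k%:R * e by rewrite /e; ring.
  by rewrite subr_ge0 leNgt ke.
move=> d l Ldl; apply/eqP; rewrite eq_le le // andbT.
by have := le _ _ (LN _ _ Ldl); rewrite mulrN lerN2.
Qed.

(** * Expected payoffs in composite and permuted games, best responses *)

Section Payoffs.
Variables (R : realType) (n : nat) (U : action_universe).
Implicit Types (G H : game R n U) (i : 'I_n).

Lemma marginal_sum1 G (p : profile G) i (x : acts G i) :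
  \sum_(a : {dffun forall j, acts G j} | a i == x)
    \prod_(j | j != i) p j (a j) = 1.
Proof.
rewrite (sum_dffun_prod_at (fun j => p j)) big1 // => j _.
exact: mixed_sum1.
Qed.

(** Grouping pure profiles by the action of player [i] shows that the payoff of a deviation is
    linear in [q]. *)
Lemma expected_payoff_dfwith G (p : profile G) i (q : mixed R (acts G i)) :
  expected_payoff (dfwith p q) i = \sum_x q x * expected_payoff_at p x.
Proof.
rewrite /expected_payoff.
rewrite (partition_big (fun a : {dffun forall j, acts G j} => a i) predT) //=.
apply: eq_bigr => x _; rewrite mulr_sumr; apply: eq_bigr => a /eqP <-.
rewrite (bigD1 i) //= dfwith_in -!mulrA; congr (_ * (_ * _)).
by apply: eq_bigr => j ji; rewrite dfwith_out // eq_sym.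
Qed.

Lemma expected_payoffE G (p : profile G) i :
  expected_payoff p i = \sum_x p i x * expected_payoff_at p x.
Proof.
rewrite -expected_payoff_dfwith; congr (expected_payoff _ i).
apply: functional_extensionality_dep => j.
by case: dfwithP.
Qed.

(** Pure profiles of the composite are pairs with product weights; the payoff from each factor is
    averaged over the weights of the other, which sum to 1. *)
Lemma expected_payoff_at_composite G H (p : profile G) (q : profile H) i
    (x : acts G i) (y : acts H i) :
  expected_payoff_at (profile_prod p q) (join_act x y : acts (composite G H) i)
  = expected_payoff_at p x + expected_payoff_at q y.
Proof.
pose K := composite G H.
pose join (ab : {dffun forall j, acts G j} * {dffun forall j, acts H j}) :
  {dffun forall j, acts K j} := [ffun j => join_act (ab.1 j) (ab.2 j)].
pose split (c : {dffun forall j, acts K j}) :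
    {dffun forall j, acts G j} * {dffun forall j, acts H j} :=
  ([ffun j => fst_act (c j)], [ffun j => snd_act (c j)]).
have joinK : cancel join split.
  case=> a b; congr (_, _); apply/ffunP => j; rewrite !ffunE.
    exact: fst_join.
  exact: snd_join.
have splitK : cancel split join.
  by move=> c; apply/ffunP => j; rewrite !ffunE join_split.
have joinE a b : (join (a, b) i == join_act x y) = (a i == x) && (b i == y).
  rewrite ffunE; apply/eqP/andP => [e|[/eqP -> /eqP ->] //].
  split; apply/eqP.
    by rewrite -(fst_join (a i) (b i)) e fst_join.
  by rewrite -(snd_join (a i) (b i)) e snd_join.
rewrite {1}/expected_payoff_at (reindex join) /=; last first.
  by exists split => c _; [exact: joinK|exact: splitK].
pose P (a : {dffun forall j, acts G j}) := \prod_(j | j != i) p j (a j).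
pose Q (b : {dffun forall j, acts H j}) := \prod_(j | j != i) q j (b j).
transitivity (\sum_(a : {dffun forall j, acts G j} | a i == x)
    \sum_(b : {dffun forall j, acts H j} | b i == y)
      (Q b * (P a * util a i) + P a * (Q b * util b i))).
  rewrite pair_big; apply: eq_big => [[a b]|[a b] _] /=; first exact: joinE.
  have -> : (fun j => fst_act (join (a, b) j)) = a.
    by apply: functional_extensionality_dep => j; rewrite ffunE fst_join.
  have -> : (fun j => snd_act (join (a, b) j)) = b.
    by apply: functional_extensionality_dep => j; rewrite ffunE snd_join.
  under eq_bigr => j _ do rewrite ffunE fst_join snd_join.
  by rewrite big_split /= -/(P a) -/(Q b); ring.
under eq_bigr => a _ do
  rewrite big_split /= -mulr_suml -mulr_sumr marginal_sum1 mul1r.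
by rewrite big_split /= -mulr_suml marginal_sum1 mul1r.
Qed.

Lemma expected_payoff_at_permuted G (p : profile G) (s : 'S_n) i
    (x : acts G (s i)) :
  expected_payoff_at (profile_perm p s) (x : acts (permuted G s) i)
  = expected_payoff_at p x.
Proof.
pose K := permuted G s.
pose f (a : {dffun forall j, acts G j}) : {dffun forall j, acts K j} :=
  [ffun j => a (s j)].
pose g (b : {dffun forall j, acts K j}) : {dffun forall j, acts G j} :=
  [ffun j => unpermute b j].
have fE a : (f a : forall j, acts K j) = fun j => a (s j).
  by apply: functional_extensionality_dep => j; rewrite ffunE.
have fK : cancel f g.
  by move=> a; apply/ffunP => j; rewrite ffunE fE unpermuteE.
have gK : cancel g f.
  move=> b; apply/ffunP => j; rewrite !ffunE /unpermute.
  (* Replacing [s^-1 (s j)] by a variable equal to [j] leaves a cast along a proof of [s j = s j],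
     trivial by uniqueness of identity proofs. *)
  move: (permKV s (s j)) (permK s j).
  by move: ((s^-1)%g (s j)) => k e ekj; subst k; rewrite eq_axiomK.
rewrite {1}/expected_payoff_at (reindex f) /=; last first.
  by exists g => a _; [exact: fK|exact: gK].
apply: eq_big => a; first by rewrite fE.
move=> _; rewrite fE unpermuteE; congr (_ * _).
rewrite [RHS](reindex_inj (@perm_inj _ s)) /=.
by apply: eq_bigl => j; rewrite (inj_eq perm_inj).
Qed.

Lemma mixed_exists_gt0 (A : {fset U}) (p : mixed R A) : exists x, 0 < p x.
Proof.
apply: contrapT => /forallNP p_le0; have := mixed_sum1 p.
rewrite big1 => [/eqP|x _]; first by rewrite eq_sym oner_eq0.
by apply/eqP; rewrite eq_le mixed_ge0 andbT leNgt; apply/negP/p_le0.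
Qed.

(** Any action of positive probability is a best response, so [p] earns the maximum over pure
    actions, and a mixed deviation only averages values at or below it. *)
Lemma Nash_best_response G (p : profile G) :
  (forall i (x y : acts G i),
    expected_payoff_at p y < expected_payoff_at p x -> p i y = 0) ->
  @Nash R n U G p.
Proof.
move=> br i q; have [x px_gt0] := mixed_exists_gt0 (p i).
have x_max (y : acts G i) : expected_payoff_at p y <= expected_payoff_at p x.
  rewrite leNgt; apply/negP => /br px0.
  by rewrite px0 ltxx in px_gt0.
rewrite expected_payoff_dfwith expected_payoffE.
apply: (@le_trans _ _ (expected_payoff_at p x)).
  rewrite -[leRHS]mul1r -(mixed_sum1 q) mulr_suml.
  by apply: ler_sum => y _; rewrite ler_wpM2l ?mixed_ge0.
rewrite -[leLHS]mul1r -(mixed_sum1 (p i)) mulr_suml.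
apply: ler_sum => y _; have := x_max y; rewrite le_eqVlt => /predU1P[->//|].
by move=> /br ->; rewrite !mul0r.
Qed.

Lemma universe_two_actions : exists u v : U, u != v.
Proof.
have [u] := universe_nonempty U; exists u.
apply: contrapT => /forallNP all_eq; apply: (universe_infinite (a := U)).
apply: (sub_finite_set _ (finite_set1 u)) => v _ /=.
by apply/esym/eqP/negPn/negP/all_eq.
Qed.

(** * Comparisons of two actions in a solution *)

Section Solutions.
Variable S : solution_concept R n U.
Hypothesis brS : permits_bracketing S.
Hypothesis moS : expectation_monotone S.
Hypothesis anS : anonymous S.

(** Hiding the game, profile and actions leaves a relation on reals, so that data from different
    games can be combined. *)
Variant comparison i : R -> R -> R -> Prop :=
  Comparison G (p : profile G) (x y : acts G i) of S G p :
    comparison i (expected_payoff_at p x - expected_payoff_at p y)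
                 (p i x) (p i y).

Lemma comparison_ge0 i d a b : comparison i d a b -> 0 <= a /\ 0 <= b.
Proof. by case=> G p x y _; rewrite !mixed_ge0. Qed.

Lemma comparison_sym i d a b : comparison i d a b -> comparison i (- d) b a.
Proof. by case=> G p x y Sp; rewrite opprB; apply: Comparison. Qed.

Lemma comparison_mono i d a b : comparison i d a b -> 0 < d -> b <= a.
Proof. by case=> G p x y Sp; rewrite subr_gt0; apply: moS. Qed.

Lemma comparisonD i d a b d' a' b' : comparison i d a b ->
  comparison i d' a' b' -> comparison i (d + d') (a * a') (b * b').
Proof.
case=> G p x y Sp [H q z t Sq].
have := @Comparison i _ _ (join_act x z : acts (composite G H) i) (join_act y t) (brS Sp Sq).
by rewrite !expected_payoff_at_composite /= !fst_join !snd_join opprD addrACA.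
Qed.

Lemma comparisonMn i d a b k : comparison i d a b ->
  comparison i (d *+ k.+1) (a ^+ k.+1) (b ^+ k.+1).
Proof.
move=> C; elim: k => [|k IH]; first by rewrite mulr1n !expr1.
by rewrite mulrS !(exprS _ k.+1); apply: comparisonD.
Qed.

Lemma comparison_anonymous i j d a b : comparison i d a b -> comparison j d a b.
Proof.
(* Written as [tperm i j j], player [i] has the same actions as player [j] of the permuted game by
   conversion, without a cast. *)
rewrite -[i](tpermR i j) => -[G p x y Sp].
have := @Comparison j _ _ (x : acts (permuted G (tperm i j)) j) y (anS (tperm i j) Sp).
by rewrite !expected_payoff_at_permuted.
Qed.

(** In the game used, each player gets 1 for [v] and 0 for [u] whatever the others do. Some action
    has positive probability; if it is [u], monotonicity gives [v] at least as much. *)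
Lemma comparison_unit i : exists a b, comparison i 1 a b /\ 0 < a.
Proof.
have [u [v uv]] := universe_two_actions.
pose A : {fset U} := [fset u; v]%fset.
have uA : u \in A by rewrite fset21.
have vA : v \in A by rewrite fset22.
have A0 : A != fset0 by apply/fset0Pn; exists u.
pose G : game R n U := @Game R n U (fun=> A) (fun=> A0) (fun a i => (val (a i) == v)%:R).
have [p Sp] := solutions_nonempty S G.
have payE (x : acts G i) : expected_payoff_at p x = (val x == v)%:R.
  rewrite /expected_payoff_at -[RHS]mul1r -[X in X * _](marginal_sum1 p x) mulr_suml.
  by apply: eq_bigr => a /eqP <-.
pose x : acts G i := [` vA]%fset; pose y : acts G i := [` uA]%fset.
have C : comparison i 1 (p i x) (p i y).
  have := Comparison x y Sp.
  by rewrite !payE /= eqxx (negPf uv) subr0.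
exists (p i x), (p i y); split=> //.
have [z pz] := mixed_exists_gt0 (p i).
have /fset2P[zE|zE] := valP z.
  apply: lt_le_trans (comparison_mono C ltr01).
  by have <- : z = y by apply: val_inj.
by have <- : z = x by apply: val_inj.
Qed.

Lemma comparison_Nash i d a : comparison i d a 0 -> 0 < d -> 0 < a ->
  refinement S (@Nash R n U).
Proof.
move=> C d_gt0 a_gt0 G p Sp; apply: Nash_best_response => j x y.
rewrite -subr_gt0.
have {C} C := comparison_anonymous j C.
have C' := Comparison x y Sp.
move: (_ - _) C' => d' C' d'_gt0.
(* Chosen so that [k + 1] copies of the gain [d'] outweigh [d]. *)
pose k := Num.bound (d / d').
have dk : d < d' *+ k.+1.
  rewrite -mulr_natl -ltr_pdivrMr //.
  apply: (@lt_le_trans _ _ k%:R); last by rewrite ler_nat.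
  by apply: archi_boundP; rewrite divr_ge0 ?ltW.
(* Reversing [C] puts its 0 on the side of [x], so monotonicity yields
   [p j y ^ (k + 1) * a <= 0]. *)
have := comparison_mono (comparisonD (comparisonMn k C') (comparison_sym C)).
rewrite subr_gt0 mulr0 => /(_ dk); rewrite pmulr_lle0 // => yk.
apply/eqP; rewrite -[_ == 0](expf_eq0 _ k.+1) eq_le yk /=.
by rewrite exprn_ge0 ?mixed_ge0.
Qed.

(** * The full-support case: logit responses *)

Section FullSupport.
Hypothesis supp : forall i d a b, comparison i d a b -> 0 < d -> 0 < a -> 0 < b.

Lemma solution_full_support G (p : profile G) i (x : acts G i) : S G p -> 0 < p i x.
Proof.
move=> Sp; have [z pz] := mixed_exists_gt0 (p i).
have C := Comparison z x Sp.
have [d_lt0|d_gt0|d0] := ltgtP (expected_payoff_at p z - expected_payoff_at p x) 0.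
- apply: lt_le_trans pz _; apply: (comparison_mono (comparison_sym C)).
  by rewrite oppr_gt0.
- exact: supp C d_gt0 pz.
(* At equal payoffs, adding the unit comparison raises the gain to 1; [supp] then makes [p i x * b]
   positive, which excludes [p i x = 0]. *)
- have [a [b [C1 a_gt0]]] := comparison_unit i.
  have := supp (comparisonD C C1); rewrite d0 add0r => /(_ ltr01 (mulr_gt0 pz a_gt0)).
  have [_ b_ge0] := comparison_ge0 C1.
  have := mixed_ge0 (p i) x; rewrite le_eqVlt => /predU1P[<-|//].
  by rewrite mul0r ltxx.
Qed.

(** Logarithms turn products of probability ratios into sums, so [additive_monotone_relation_linear]
    applies, with [lambda] the log-ratio at gain 1. *)
Lemma full_support_LQRE (i0 : 'I_n) :
  exists lambda, 0 <= lambda /\ refinement S (@LQRE R n U lambda).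
Proof.
pose L d l := exists a b, [/\ comparison i0 d a b, 0 < a, 0 < b & l = ln a - ln b].
have LD d l d' l' : L d l -> L d' l' -> L (d + d') (l + l').
  move=> [a [b [C a0 b0 ->]]] [a' [b' [C' a'0 b'0 ->]]].
  exists (a * a'), (b * b'); split; rewrite ?mulr_gt0 //; first exact: comparisonD.
  by rewrite !lnM ?posrE // opprD addrACA.
have LN d l : L d l -> L (- d) (- l).
  move=> [a [b [C a0 b0 ->]]]; exists b, a; rewrite opprB; split=> //.
  exact: comparison_sym.
have Lpos d l : L d l -> 0 < d -> 0 <= l.
  move=> [a [b [C a0 b0 ->]]] d0; rewrite subr_ge0 ler_ln ?posrE //.
  exact: comparison_mono C d0.
have [a [b [C a_gt0]]] := comparison_unit i0.
pose lambda := ln a - ln b.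
have L1 : L 1 lambda.
  by exists a, b; split=> //; apply: supp C ltr01 a_gt0.
exists lambda; split; first exact: Lpos L1 ltr01.
move=> G p Sp i x.
(* The logit ratio, cross-multiplied; summing over [y], where [p i] has mass 1, gives the normalised
   formula. *)
have Lp y : p i x * expR (lambda * expected_payoff_at p y)
            = expR (lambda * expected_payoff_at p x) * p i y.
  have px := solution_full_support x Sp; have py := solution_full_support y Sp.
  have /(additive_monotone_relation_linear LD LN Lpos L1) e :
    L (expected_payoff_at p x - expected_payoff_at p y) (ln (p i x) - ln (p i y)).
    exists (p i x), (p i y); split=> //.
    exact/comparison_anonymous/Comparison.
  rewrite -[p i x]lnK ?posrE // -[p i y]lnK ?posrE // -!expRD.
  by congr expR; lra.
have sum_gt0 : 0 < \sum_(y : acts G i) expR (lambda * expected_payoff_at p y).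
  rewrite (bigD1 x) //= ltr_pwDl ?expR_gt0 // sumr_ge0 // => y _.
  exact: expR_ge0.
apply: (@mulIf _ (\sum_(y : acts G i) expR (lambda * expected_payoff_at p y))).
  by rewrite gt_eqF.
rewrite divfK ?gt_eqF // mulr_sumr -[RHS]mulr1 -(mixed_sum1 (p i)) mulr_sumr.
by apply: eq_bigr => y _; apply: Lp.
Qed.

End FullSupport.
End Solutions.
End Payoffs.

Theorem theorem1 (R : realType) (n : nat) (n_ge2 : (2 <= n)%N) (U : action_universe)
    (S : solution_concept R n U) :
  permits_bracketing S -> expectation_monotone S -> anonymous S ->
  refinement S (@Nash R n U) \/
  exists lambda : R, 0 <= lambda /\ refinement S (@LQRE R n U lambda).
Proof.
move=> brS moS anS; pose i0 := Ordinal (ltnW n_ge2).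
have [[d [a [C d_gt0 a_gt0]]]|no_zero] :=
  pselect (exists d a, [/\ comparison S i0 d a 0, 0 < d & 0 < a]).
  by left; apply: comparison_Nash C d_gt0 a_gt0.
(* Anonymity carries a zero for any player over to [i0], so its absence there gives [supp] for all
   players. *)
right; apply: full_support_LQRE => // i d a b C d_gt0 a_gt0.
have [_] := comparison_ge0 C; rewrite le_eqVlt => /predU1P[b0|//].
case: no_zero; exists d, a; split=> //; rewrite b0.
exact: comparison_anonymous C.
Qed.
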